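(* Let $q$ be a prime power and let $\mathcal{C}\le \mathcal{L}_{4,q}[x]$ be an $\mathbb{F}_{q^4}$-linear MRD code of dimension $2$ over $\mathbb{F}_{q^4}$. Then there exists $\delta\in\mathbb{F}_{q^4}$ with $\mathrm{N}_{q^4/q}(\delta)\neq 1$ such that $\mathcal{C}$ is linearly equivalent to $$\mathcal{T}_{2,1,4}(\delta)=\langle x^{q},\, x+\delta x^{q^{2}}\rangle_{\mathbb{F}_{q^4}}.$$
   Context: For a prime power $q$ and $m\ge 1$, $\mathcal{L}_{m,q}[x]$ is the set of linearized polynomials $f=\sum_{i=0}^{m-1} f_i x^{q^i}$ with $f_i\in\mathbb{F}_{q^m}$ (i.e. $q$-polynomials modulo $x^{q^m}-x$), with addition and composition modulo $x^{q^m}-x$; it is an $\mathbb{F}_{q^m}$-vector space of dimension $m$ under left multiplication by scalars, and is identified with $\mathrm{End}_{\mathbb{F}_q}(\mathbb{F}_{q^m})$ via evaluation. The rank of $f$ is $\mathrm{rk}(f)=\dim_{\mathbb{F}_q}(\mathrm{Im} f)$, and the distance between $f$ and $g$ is $\mathrm{rk}(f-g)$. An $\mathbb{F}_{q^m}$-linear rank-metric code in $\mathcal{L}_{m,q}[x]$ is a nonzero $\mathbb{F}_{q^m}$-linear subspace $\mathcal{C}$; its dimension is its $\mathbb{F}_{q^m}$-dimension. A code of dimension $k$ is MRD (maximum rank distance) if the minimum rank of its nonzero elements equals $m-k+1$. Two codes $\mathcal{C}_1,\mathcal{C}_2\le\mathcal{L}_{m,q}[x]$ are linearly equivalent if there is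 an invertible $q$-polynomial $g\in\mathcal{L}_{m,q}[x]$ with $\mathcal{C}_1=\mathcal{C}_2\circ g=\{f\circ g: f\in\mathcal{C}_2\}$. $\mathrm{N}_{q^4/q}(\delta)=\delta^{1+q+q^2+q^3}$ is the norm from $\mathbb{F}_{q^4}$ to $\mathbb{F}_q$. *)

(* Defs.v *)
From HB Require Import structures.
From mathcomp Require Import all_boot fingroup ssralg finalg zmodp poly polydiv.
From mathcomp Require Import matrix vector pgroup abelian fieldext finfield.

Set Implicit Arguments.
Unset Strict Implicit.
Unset Printing Implicit Defensive.

Import GRing.Theory.

Local Open Scope ring_scope.

(* F is the field F_q (so q = #|F|) and L is its extension F_{q^m}; the       *)
(* relation \dim {:L} = m is a hypothesis of the statements, which keeps the  *)
(* index type 'I_m concrete. The F_{q^m}-vector space L_{m,q}[x] is           *)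
(* represented by the row vectors of coefficients: f : 'rV[L]_m stands for    *)
(* \sum_(i < m) f_i x^(q^i), the reduced representative of its class modulo   *)
(* x^(q^m) - x.                                                               *)

Section LinearizedPolynomials.

Variables (F : finFieldType) (L : fieldExtType F) (m : nat).

Local Notation q := #|F|.

Implicit Types f g : 'rV[L]_m.

Definition lpoly f : {poly L} := \sum_(i < m) f 0 i *: 'X^(q ^ i).

Definition leval f (x : L) : L := (lpoly f).[x].

Lemma lpoly_linear : linear lpoly.
Proof.
move=> a f g; rewrite /lpoly scaler_sumr -big_split /=.
by apply: eq_bigr => i _; rewrite !mxE scalerDl scalerA.
Qed.

HB.instance Definition _ :=
  GRing.isLinear.Build L 'rV[L]_m {poly L} _ lpoly lpoly_linear.

Lemma expr_q_linear (i : nat) (c : F) (x y : L) :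
  (c *: x + y) ^+ (q ^ i) = c *: x ^+ (q ^ i) + y ^+ (q ^ i).
Proof.
have [p pr_p pcharF] := finPcharP F.
have pcharL : p \in [pchar L] by rewrite pchar_lalg.
have qnat : [pchar L].-nat (q ^ i)%N.
  rewrite pnatX (eq_pnat _ (pcharf_eq pcharL)).
  have := abelem_pgroup (fin_ring_pchar_abelem pcharF).
  by rewrite /pgroup cardsT => ->.
rewrite exprDn_pchar // exprZn; congr (_ *: _ + _).
by elim: i {qnat} => // i IHi; rewrite expnS exprM expf_card.
Qed.

Lemma leval_linear f : linear (leval f).
Proof.
move=> c x y; rewrite /leval /lpoly !horner_sum scaler_sumr -big_split /=.
apply: eq_bigr => i _.
by rewrite !hornerZ !hornerXn expr_q_linear mulrDr scalerAr.
Qed.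

HB.instance Definition _ f :=
  GRing.isLinear.Build F L L _ (leval f) (leval_linear f).

Definition lrank f : nat := \dim (limg (linfun (leval f))).

(* Composition modulo x^(q^m) - x. *)
Definition lcomp f g : 'rV[L]_m :=
  \row_(i < m) ((lpoly f \Po lpoly g) %% ('X^(q ^ m) - 'X))`_(q ^ i).

(* The monomial x^(q^k), for k < m. *)
Definition lmono (k : nat) : 'rV[L]_m := \row_(i < m) (i == k :> nat)%:R.

Definition linvertible g : Prop :=
  exists h, lcomp g h = lmono 0 /\ lcomp h g = lmono 0.

Definition is_min_rank (C : {vspace 'rV[L]_m}) (d : nat) : Prop :=
  (exists2 f, f \in C /\ f != 0 & lrank f = d)
  /\ (forall f, f \in C -> f != 0 -> (d <= lrank f)%N).

(* The existence of a nonzero codeword is part of is_min_rank, so an MRD code *)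
(* is a nonzero subspace. *)
Definition is_MRD (C : {vspace 'rV[L]_m}) : Prop :=
  is_min_rank C (m - \dim C + 1).

Definition linearly_equivalent (C1 C2 : {vspace 'rV[L]_m}) : Prop :=
  exists2 g, linvertible g
    & forall f, f \in C1 <-> exists2 f', f' \in C2 & f = lcomp f' g.

End LinearizedPolynomials.

Arguments lmono {F L m} k.

Definition T214 (F : finFieldType) (L : fieldExtType F) (delta : L) :
    {vspace 'rV[L]_4} :=
  <<[:: lmono 1; (lmono 0 + delta *: lmono 2)%R]>>%VS.

(* Main.v *)
(**
  Write phi(x) = x^q. Composing with the inverse of an invertible codeword, C
  is spanned by x and v = a phi(x) + b phi^2(x) + c phi^3(x). The target form
  means that C is spanned by some invertible g and a combination of phi o g and
  phi^3 o g. Such a g is sought as v + t x (or x itself when b = 0), which turns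
  the condition into an equation of degree (1, 1) in t and phi^2(t). That
  equation reduces to a quadratic equation whose coefficients turn out to lie in
  F_q, hence it is solvable in F_{q^2}. The MRD property enters only through the
  fact that a nonzero codeword has a kernel of dimension at most 1: it provides
  the invertible codeword, makes g invertible, and excludes norm 1, because
  by Hilbert 90 and an isotropy argument T(delta) contains a polynomial of rank
  at most 2 when N(delta) = 1.
*)
Require Import Defs.
From HB Require Import structures.
From mathcomp Require Import all_boot fingroup ssralg finalg zmodp poly polydiv.
From mathcomp Require Import matrix vector pgroup abelian fieldext finfield.
From mathcomp Require Import ring.

Set Implicit Arguments.
Unset Strict Implicit.
Unset Printing Implicit Defensive.

Import GRing.Theory.

Local Open Scope ring_scope.

(** * Fields with an automorphism of order dividing 4 *)

Section OrderFourAutomorphism.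

Variables (K : fieldType) (phi : {rmorphism K -> K}).
Hypothesis phi4 : forall x, phi (phi (phi (phi x))) = x.

(** * Trace, norm and Hilbert 90 *)

Definition tr4 x := x + phi x + phi (phi x) + phi (phi (phi x)).
Definition nm4 x := x * phi x * phi (phi x) * phi (phi (phi x)).

Lemma phi_tr4 x : phi (tr4 x) = tr4 x.
Proof. by rewrite /tr4 !rmorphD /= phi4; ring. Qed.

Lemma phi_nm4 x : phi (nm4 x) = nm4 x.
Proof. by rewrite /nm4 !rmorphM /= phi4; ring. Qed.

Hypothesis independent : forall c0 c1 c2 c3 : K, c0 != 0 ->
  exists x, c0 * x + c1 * phi x + c2 * phi (phi x)
            + c3 * phi (phi (phi x)) != 0.

(** For trace zero [r], the sum [s] satisfies s - phi(s) = r tr4(theta), and theta is chosen with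
    nonzero trace. *)
Lemma additive_hilbert90 r : tr4 r = 0 -> exists t, t - phi t = r.
Proof.
have [theta] := independent 1 1 1 (oner_neq0 K).
rewrite !mul1r -/(tr4 theta) => tr_theta0 tr_r.
pose s := r * phi theta + (r + phi r) * phi (phi theta)
          + (r + phi r + phi (phi r)) * phi (phi (phi theta)).
exists (s / tr4 theta); rewrite fmorph_div /= phi_tr4.
apply: (mulIf tr_theta0); rewrite mulrBl !divfK // /s /tr4.
rewrite !(rmorphD, rmorphM) /= phi4.
have -> : phi (phi (phi r)) = - (r + phi r + phi (phi r)).
  by apply/eqP; rewrite -addr_eq0 addrC [X in X == _]tr_r.
by ring.
Qed.

(** The witness is a Lagrange resolvent of theta: x -> delta phi(x) permutes its four terms
    cyclically because delta has norm 1. *)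
Lemma multiplicative_hilbert90 delta :
  nm4 delta = 1 -> exists2 d, d != 0 & delta * phi d = d.
Proof.
move=> nd; have [theta d0] := independent delta (delta * phi delta)
  (delta * phi delta * phi (phi delta)) (oner_neq0 K).
eexists; first exact: d0.
rewrite !(rmorphD, rmorphM, rmorph1) /= phi4.
by rewrite -[X in _ = X * theta + _ + _ + _]nd /nm4; ring.
Qed.

Hypothesis norm_surjective1 : forall k, phi k = k ->
  exists2 u, phi (phi u) = u & u * phi u = k.

(* [tr4 (d * (y * phi y))] is a Hermitian form over the fixed field of phi^2:
   1 + u y with y orthogonal to 1 is isotropic for u of a suitable norm. *)
Lemma isotropic_vector d : exists2 y, y != 0 & tr4 (d * (y * phi y)) = 0.
Proof.
have [trd0|trd_neq0] := eqVneq (tr4 d) 0.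
  by exists 1; rewrite ?oner_neq0 // rmorph1 !mulr1.
have [z v0] := independent 0 (-1) 0 (oner_neq0 K).
pose v := z - phi (phi z).
have v_neq0 : v != 0 by move: v0; rewrite !mul0r mul1r mulN1r !addr0.
have v2 : phi (phi v) = - v by rewrite /v !rmorphB /= phi4 opprB.
clearbody v.
(* The cross term of the form at 1 + u y is [tr4 (u * y * e)]. For [u] fixed by phi^2 it vanishes as
   soon as phi^2 negates [y * e], which y = v / e ensures. *)
pose e := d + phi (phi (phi d)).
have eD : e + phi (phi e) = tr4 d by rewrite /e /tr4 !rmorphD /= phi4; ring.
have e_neq0 : e != 0.
  by apply: contraNneq trd_neq0 => e0; rewrite -eD e0 !rmorph0 addr0.
pose y := v / e.
have y_neq0 : y != 0 by rewrite mulf_neq0 ?invr_eq0.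
have ye : y * e + phi (phi y) * phi (phi e) = 0.
  by rewrite -!rmorphM /= divfK // v2 subrr.
clearbody y.
have [try0|try_neq0] := eqVneq (tr4 (d * (y * phi y))) 0; first by exists y.
have [|u u2 uE] := @norm_surjective1 (- tr4 d / tr4 (d * (y * phi y))).
  by rewrite fmorph_div rmorphN /= !phi_tr4.
exists (1 + u * y).
  (* If 1 + u y = 0, then y = - 1 / u is fixed by phi^2, so [y * tr4 d] is the left side of [ye],
     namely 0. *)
  apply: contra_neq (mulf_neq0 y_neq0 trd_neq0) => uy.
  have yu : y = - u^-1.
    have u_neq0 : u != 0.
      by apply: contra_eq_neq uy => ->; rewrite mul0r addr0 oner_eq0.
    apply: (mulfI u_neq0); rewrite mulrN divff //.
    by apply/eqP; rewrite -addr_eq0 addrC uy.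
  by rewrite -eD mulrDr -[RHS]ye yu !rmorphN !fmorphV /= u2.
transitivity (tr4 d + u * (y * e + phi (phi y) * phi (phi e))
   + phi u * phi (y * e + phi (phi y) * phi (phi e))
   + (u * phi u) * tr4 (d * (y * phi y))).
  rewrite /tr4 /e !(rmorphD, rmorphM, rmorph1) /= !phi4 !u2; ring.
by rewrite ye rmorph0 !mulr0 !addr0 uE divfK // subrr.
Qed.

(* The element a phi(y) + b (y + delta phi^2(y)) of T(delta), with
   a = x + delta phi^2(x) and b = - phi(x), vanishes at both x and t x. *)
Lemma norm1_degenerate delta : nm4 delta = 1 ->
  exists x t, [/\ x != 0, phi t != t &
    phi x * (t * x + delta * phi (phi (t * x)))
    = phi (t * x) * (x + delta * phi (phi x))].
Proof.
case/multiplicative_hilbert90 => d d_neq0 dE.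
have [y y_neq0 /additive_hilbert90[t tE]] := isotropic_vector d.
have y1 : phi y != 0 by rewrite fmorph_eq0.
have y2 : phi (phi y) != 0 by rewrite !fmorph_eq0.
have d1 : phi d != 0 by rewrite fmorph_eq0.
(* With r = t - phi(t), dividing by phi(x) leaves r x = delta phi(r) phi^2(x). Since delta phi(d) =
   d, this holds for r = d y phi(y) and x = 1 / y. *)
exists y^-1, t; split; first by rewrite invr_eq0.
  by rewrite eq_sym -subr_eq0 tE !mulf_neq0.
have tE1 : phi t = t - d * (y * phi y) by rewrite -tE; ring.
have -> : delta = d / phi d by rewrite -[X in X / _]dE mulfK.
rewrite !(rmorphM, fmorphV) /= tE1 !(rmorphB, rmorphM) /= tE1.
by field; rewrite ?y_neq0 ?y1 ?y2 ?d1.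
Qed.

(** * A semilinear equation of degree (1, 1) *)

Hypothesis quadratic_root : forall e n, phi e = e -> phi n = n ->
  exists2 x, x ^+ 2 - e * x + n = 0 & phi (phi x) = x.

Hypothesis norm_surjective : forall k, phi (phi k) = k ->
  exists z, z * phi (phi z) = k.

(** This is the vanishing of the determinant that arises in [frobenius_pair]. *)
Lemma semilinear_equation (a b c : K) (b0 : b != 0) :
  exists t, (phi (phi t) - c * phi (phi (phi c)) / b) * (t - a * phi a / b)
   = (c * phi a / b - phi b)
     * (a * phi (phi (phi c)) / b - phi (phi (phi b))).
Proof.
pose kappa := (c * phi a / b - phi b)
     * (a * phi (phi (phi c)) / b - phi (phi (phi b))).
pose mu := phi (phi (a * phi a / b)) - c * phi (phi (phi c)) / b.
have b2 : phi (phi b) != 0 by rewrite !fmorph_eq0.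
suff [z zE] : exists z : K, z * (phi (phi z) + mu) = kappa.
  exists (z + a * phi a / b); rewrite -/kappa -zE /mu !rmorphD /=.
  by ring.
(* An n fixed by phi^2 with (kappa - n) (phi^2(kappa) - n) = n mu phi^2(mu)
   gives the solution z = (kappa - n) / mu, whose norm to the fixed field of
   phi^2 is n. The quadratic equation satisfied by m = n b phi^2(b) has
   coefficients e and nm4 p fixed by phi. *)
pose p := phi a * c - b * phi b.
pose e := nm4 a + nm4 c + (nm4 b + nm4 b)
          - tr4 (phi a * c * phi (phi b) * phi (phi (phi b))).
have [||m mE m2] := @quadratic_root e (nm4 p).
- by rewrite /e rmorphB phi_tr4 !rmorphD /= !phi_nm4.
- exact: phi_nm4.
pose n := m / (b * phi (phi b)).
have n2 : phi (phi n) = n.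
  by rewrite /n !fmorph_div !rmorphM /= phi4 m2 [phi (phi b) * _]mulrC.
have nE : (kappa - n) * (phi (phi kappa) - n) = n * (mu * phi (phi mu)).
  apply/eqP; rewrite -subr_eq0; apply/eqP.
  transitivity ((m ^+ 2 - e * m + nm4 p) / (b * phi (phi b)) ^+ 2).
    rewrite /kappa /mu /n /e /p /nm4 /tr4.
    rewrite !(rmorphD, rmorphN, rmorphM, fmorphV) /= !phi4.
    by field; rewrite b0 b2.
  by rewrite mE mul0r.
clearbody kappa mu n.
have [mu0|mu_neq0] := eqVneq mu 0; last first.
  exists ((kappa - n) / mu).
  have mu2_neq0 : phi (phi mu) != 0 by rewrite !fmorph_eq0.
  apply: (mulIf mu_neq0); apply: (mulIf mu2_neq0).
  rewrite !(rmorphD, rmorphN, rmorphM, fmorphV) /= n2.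
  transitivity ((kappa - n) * (phi (phi kappa) - n)
                + (kappa - n) * mu * phi (phi mu)).
    by field; rewrite ?mu_neq0 ?mu2_neq0.
  by rewrite nE; ring.
have [|z zE] := @norm_surjective kappa; last by exists z; rewrite mu0 addr0.
(* For mu = 0 one factor in [nE] vanishes, so kappa equals n, is fixed by phi^2, and is therefore a
   norm. *)
move/eqP: nE; rewrite mu0 mul0r mulr0 mulf_eq0 !subr_eq0.
by case/orP=> /eqP kn; [rewrite kn | rewrite -[RHS]phi4 kn n2].
Qed.

End OrderFourAutomorphism.

(** * Linearized polynomials as functions *)

Section LinearizedPolynomialFunctions.

Variables (F : finFieldType) (L : fieldExtType F).

Local Notation q := #|F|.
Local Notation fL := (finvect_type L).

Lemma expr_cardD i (x y : L) : (x + y) ^+ (q ^ i) = x ^+ (q ^ i) + y ^+ (q ^ i).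
Proof. by have := expr_q_linear i 1 x y; rewrite !scale1r. Qed.

Definition frob (x : L) := x ^+ q.

Lemma frob_is_additive : zmod_morphism frob.
Proof.
move=> x y; rewrite /frob.
have := expr_cardD 1 (x - y) y; rewrite subrK !expn1 => ->.
by rewrite addrK.
Qed.

Lemma frob_is_monoid_morphism : monoid_morphism frob.
Proof. by split=> [|x y]; rewrite /frob (expr1n, exprMn). Qed.

HB.instance Definition _ := GRing.isZmodMorphism.Build L L frob frob_is_additive.
HB.instance Definition _ :=
  GRing.isMonoidMorphism.Build L L frob frob_is_monoid_morphism.

Lemma iter_frob i x : iter i frob x = x ^+ (q ^ i).
Proof. by elim: i => // i IHi; rewrite iterS IHi /frob -exprM expnSr. Qed.

Lemma frob_alg (c : F) : frob c%:A = c%:A.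
Proof. by rewrite /frob exprZn expr1n expf_card. Qed.

(** * Norm and quadratic equations over finite fields *)

Lemma expr_card_ext x : x ^+ #|{: fL}| = x :> L.
Proof. exact: (expf_card (x : fL)). Qed.

(** X^#|L| - X is a product of linear factors over L, so each nonconstant divisor is one too. *)
Lemma dvdp_card_root (p : {poly L}) :
  p %| 'X^#|{: fL}| - 'X -> size p != 1 -> exists x, root p x.
Proof.
move=> p_dv sz_p; have := p_dv; rewrite (finField_genPoly fL).
move=> /(@dvdp_prod_XsubC L _ _ id)[m p_eq].
have: size (mask m (index_enum fL)) != 0.
  apply: contraNneq sz_p => /size0nil s0.
  by rewrite (eqp_size p_eq) s0 big_nil size_poly1.
case: (mask m _) p_eq => // x r p_eq _; exists x.
by rewrite (eqp_root p_eq) big_cons rootM root_XsubC eqxx.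
Qed.

Lemma poly_expr_cardD (p1 p2 : {poly L}) : (p1 + p2) ^+ q = p1 ^+ q + p2 ^+ q.
Proof.
have [p pr_p pcharF] := finPcharP F; apply: exprDn_pchar.
have pcharL : p \in [pchar {poly L}] by rewrite pchar_poly pchar_lalg.
rewrite (eq_pnat _ (pcharf_eq pcharL)).
by have := abelem_pgroup (fin_ring_pchar_abelem pcharF); rewrite /pgroup cardsT.
Qed.

Lemma poly_expr_cardN (p : {poly L}) : (- p) ^+ q = - p ^+ q.
Proof.
apply/eqP; rewrite -addr_eq0 -poly_expr_cardD addNr expr0n.
by rewrite gtn_eqF // (ltn_trans _ (finNzRing_gt1 F)).
Qed.

Lemma dvdp_expX_pow n k : 'X^n - 'X %| ('X^(n ^ k) - 'X : {poly L}).
Proof.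
elim: k => [|k IHk]; first by rewrite expr1 subrr dvdp0.
rewrite -(subrK 'X^n 'X^(n ^ k.+1)) -addrA dvdp_addl //.
by rewrite expnSr exprM subrXX dvdp_mulr.
Qed.

Lemma norm_root r k c : (#|{: fL}| = (r ^ 2) ^ k)%N -> c ^+ r = c ->
  exists2 x : L, x ^+ (r ^ 2) = x & x * x ^+ r = c.
Proof.
move=> cardL cr; have r_gt1 : (1 < r)%N.
  have := finNzRing_gt1 fL; rewrite cardL -expnM.
  by case: r {cardL cr} => [|[|r]] //; [case: k => // k; rewrite exp0n | rewrite exp1n].
have [->|c0] := eqVneq c 0.
  by exists 0; rewrite ?mul0r // expr0n; case: r {cardL cr} r_gt1 => [|[]].
have [||x] := @dvdp_card_root ('X^(r.+1) - c%:P).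
- rewrite cardL; apply: dvdp_trans (dvdp_expX_pow _ _).
  (* As c is nonzero, X^(r^2) - X may be multiplied by X^r. The product is (X^(r+1))^r - X^(r+1),
     and c^r = c makes it vanish modulo X^(r+1) - c. *)
  have /Gauss_dvdpr <- : coprimep ('X^(r.+1) - c%:P) 'X^r.
    rewrite coprimep_expr // coprimepX rootE !hornerE expr0n /= sub0r.
    by rewrite oppr_eq0.
  rewrite mulrBr -exprD -exprSr.
  have -> : (r + r ^ 2 = r.+1 * r)%N by rewrite mulSn mulnn.
  have -> : 'X^(r.+1 * r) - 'X^(r.+1)
      = ('X^(r.+1) ^+ r - c%:P ^+ r) - ('X^(r.+1) - c%:P) :> {poly L}.
    by rewrite -rmorphXn /= cr exprM; ring.
  by rewrite dvdp_sub // subrXX dvdp_mulr.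
- by rewrite size_XnsubC // eqSS gtn_eqF // ltnW.
rewrite rootE !hornerE subr_eq0 => /eqP xE; exists x; last by rewrite -exprS.
have x0 : x != 0.
  by apply: contraNneq c0 => x0; rewrite -xE x0 expr0n.
have xr : x ^+ r = c / x by rewrite -xE exprSr mulfK.
by rewrite exprM xr expr_div_n cr xr invf_div mulrC divfK.
Qed.

Lemma quadratic_root k (e n : L) : (#|{: fL}| = (q ^ 2) ^ k)%N ->
  frob e = e -> frob n = n ->
  exists2 x, x ^+ 2 - e * x + n = 0 & frob (frob x) = x.
Proof.
move=> cardL eq nq.
pose p : {poly L} := 'X ^+ 2 - e%:P * 'X + n%:P.
have sz_p : size p = 3.
  rewrite /p -addrA size_polyDl ?size_polyXn // (leq_ltn_trans (size_polyD _ _)) //.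
  rewrite gtn_max size_polyN mul_polyC.
  rewrite (leq_ltn_trans (size_scale_leq _ _)) ?size_polyX //.
  by rewrite (leq_ltn_trans (size_polyC_leq1 _)).
have X2_dv : 'X^(q ^ 2) - 'X %| ('X^#|{: fL}| - 'X : {poly L}).
  by rewrite cardL dvdp_expX_pow.
(* As p(X^q) = p^q, p divides (X^q - X)(X^q - (e - X)). The first factor divides
   X^(q^2) - X, and so does p if it divides the second one. *)
have [x px] : exists x, root p x.
  have pAB : p %| ('X^q - 'X) * ('X^q + 'X - e%:P).
    have -> : ('X^q - 'X) * ('X^q + 'X - e%:P) = p ^+ q - p.
      rewrite /p !(poly_expr_cardD, poly_expr_cardN) !exprMn -!rmorphXn /=.
      by rewrite -/(frob e) -/(frob n) eq nq; ring.
    by rewrite dvdp_sub // dvdp_exp // ltnW ?finNzRing_gt1.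
  have [copA|] := boolP (coprimep p ('X^q - 'X)).
    apply: dvdp_card_root; last by rewrite sz_p.
    apply: dvdp_trans X2_dv.
    have pB : p %| 'X^q + 'X - e%:P by rewrite -(Gauss_dvdpr _ copA).
    have -> : 'X^(q ^ 2) - 'X
              = ('X^q + 'X - e%:P) ^+ q - ('X^q + 'X - e%:P) :> {poly L}.
      rewrite !(poly_expr_cardD, poly_expr_cardN) -!rmorphXn /=.
      by rewrite -exprM -/(frob e) eq; ring.
    by rewrite dvdp_sub // dvdp_exp // ltnW ?finNzRing_gt1.
  move=> /(@dvdp_card_root (gcdp p ('X^q - 'X)))[|x].
    apply: dvdp_trans (dvdp_gcdr _ _) (dvdp_trans _ X2_dv).
    by rewrite dvdp_expX_pow.
  by rewrite root_gcd => /andP[px _]; exists x.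
have xE : x ^+ 2 - e * x + n = 0.
  by move: px; rewrite rootE !hornerE => /eqP.
exists x => //.
(* [frob x] is again a root of p, hence it is x or the other root e - x. *)
have : (frob x - x) * (frob x + x - e) = 0.
  have := congr1 frob xE; rewrite !(rmorphD, rmorphN, rmorphM, rmorphXn) /=.
  rewrite eq nq rmorph0 => xE1.
  by rewrite -[RHS](subrr 0) -[in X in _ = X - _]xE1 -[in X in _ = _ - X]xE; ring.
move/eqP; rewrite mulf_eq0 subr_eq0 => /orP[/eqP xx|]; first by rewrite !xx.
move/eqP=> xx; have {}xx : frob x = e - x.
  by apply/eqP; rewrite -subr_eq0 -[X in _ == X]xx; apply/eqP; ring.
by rewrite xx rmorphB /= eq xx; ring.
Qed.

(** * Evaluation and composition modulo x^(q^m) - x *)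

Section FixedDegree.

Variables (m : nat) (dimL : \dim {:L} = m).

Implicit Types f g h : 'rV[L]_m.

Lemma card_ext : #|{: fL}| = (q ^ m)%N.
Proof. by rewrite -(card_vspacef (Vector.class fL)) card_vspace dimL. Qed.

Lemma degree_gt0 : (0 < m)%N.
Proof. by have := finNzRing_gt1 fL; rewrite card_ext; case: m. Qed.

Lemma expr_card_dim (x : L) : x ^+ (q ^ m) = x.
Proof. by rewrite -card_ext expr_card_ext. Qed.

Lemma coef_lpoly f (i : 'I_m) : (lpoly f)`_(q ^ i) = f 0 i.
Proof.
rewrite /lpoly coef_sum (bigD1 i) //= coefZ coefXn eqxx mulr1 big1 ?addr0 //.
move=> j ne_ji; rewrite coefZ coefXn eqn_exp2l ?finNzRing_gt1 //.
by rewrite eq_sym (inj_eq val_inj) (negPf ne_ji) mulr0.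
Qed.

Lemma levalE f x : leval f x = \sum_(i < m) f 0 i * x ^+ (q ^ i).
Proof.
rewrite /leval /lpoly horner_sum; apply: eq_bigr => i _.
by rewrite hornerZ hornerXn.
Qed.

Lemma size_lpoly f : (size (lpoly f) <= q ^ m)%N.
Proof.
apply: (big_ind (fun p : {poly L} => size p <= q ^ m)%N) => [|p1 p2 s1 s2|i _].
- by rewrite size_poly0.
- by rewrite (leq_trans (size_polyD _ _)) // geq_max s1.
rewrite (leq_trans (size_scale_leq _ _)) // size_polyXn.
by rewrite ltn_exp2l ?finNzRing_gt1.
Qed.

Lemma horner_eq0_small (p : {poly L}) :
  (size p <= q ^ m)%N -> (forall x, p.[x] = 0) -> p = 0.
Proof.
move=> sz_p p0; apply/eqP; apply: contraLR sz_p => p_neq0; rewrite -ltnNge.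
rewrite -card_ext cardE; apply: (max_poly_roots p_neq0 _ (enum_uniq fL)).
by apply/allP => x _; rewrite rootE p0.
Qed.

Lemma leval_eq0 f : (forall x, leval f x = 0) -> f = 0.
Proof.
move=> f0; apply/rowP => i; rewrite mxE -coef_lpoly.
by rewrite (horner_eq0_small (size_lpoly f) f0) coef0.
Qed.

Lemma leval_subl f g x : leval (f - g) x = leval f x - leval g x.
Proof. by rewrite /leval linearB hornerD hornerN. Qed.

Lemma leval_addl f g x : leval (f + g) x = leval f x + leval g x.
Proof. by rewrite /leval linearD hornerD. Qed.

Lemma leval_scalel a f x : leval (a *: f) x = a * leval f x.
Proof. by rewrite /leval linearZ hornerZ. Qed.

Lemma leval_inj f g : leval f =1 leval g -> f = g.
Proof.
move=> eq_fg; apply/eqP; rewrite -subr_eq0; apply/eqP/leval_eq0 => x.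
by rewrite leval_subl eq_fg subrr.
Qed.

Lemma expr_modn k (x : L) : x ^+ (q ^ (k %% m)%N) = x ^+ (q ^ k).
Proof.
rewrite [in RHS](divn_eq k m) expnD exprM; congr (_ ^+ _).
elim: (k %/ m)%N => [|n IHn]; first by rewrite expr1.
by rewrite mulSn expnD exprM expr_card_dim.
Qed.

(* x^(q^k) o g, reduced modulo x^(q^m) - x. *)
Definition lfrob k g : 'rV[L]_m :=
  \row_l \sum_(j < m | ((j + k) %% m)%N == l) g 0 j ^+ (q ^ k).

Lemma leval_lfrob k g x : leval (lfrob k g) x = leval g x ^+ (q ^ k).
Proof.
have m_gt0 := degree_gt0.
have expr0 : (0 : L) ^+ (q ^ k) = 0.
  by rewrite expr0n gtn_eqF // expn_gt0 ltnW ?finNzRing_gt1.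
rewrite !levalE (big_morph _ (expr_cardD k) expr0).
pose h (j : 'I_m) := Ordinal (ltn_pmod (j + k) m_gt0).
rewrite [RHS](partition_big h xpredT) //=; apply: eq_bigr => l _.
rewrite mxE mulr_suml; apply: eq_big => [j|j /eqP jE]; first by rewrite -val_eqE.
by rewrite exprMn -exprM -expnD -jE expr_modn.
Qed.

(** Composition is linear in [f], and the matrix is the Dickson matrix of [g]. Both sides have
    degree below q^m and agree at the q^m points of L. *)
Lemma lcompE f g : lcomp f g = f *m \matrix_i lfrob i g.
Proof.
rewrite mulmx_sum_row; set r := \sum_(i < m) _.
have rE x : leval r x = leval f (leval g x).
  rewrite /r [RHS]levalE [LHS]/leval linear_sum horner_sum; apply: eq_bigr => i _.
  by rewrite -/(leval _ x) leval_scalel rowK leval_lfrob.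
pose D : {poly L} := 'X^(q ^ m) - 'X.
have szD : size D = (q ^ m).+1.
  rewrite size_polyDl size_polyXn // size_polyN size_polyX ltnS.
  by rewrite -card_ext (finNzRing_gt1 fL).
have PE : (lpoly f \Po lpoly g) %% D = lpoly r.
  apply/eqP; rewrite -subr_eq0; apply/eqP/horner_eq0_small => [|x].
    rewrite (leq_trans (size_polyD _ _)) // size_polyN geq_max size_lpoly andbT.
    by rewrite -ltnS -szD ltn_modpN0 // -size_poly_eq0 szD.
  rewrite hornerD hornerN -/(leval r x) rE /leval -horner_comp.
  have /(congr1 (horner^~ x)) := divp_eq (lpoly f \Po lpoly g) D.
  rewrite hornerD hornerM {2}/D !hornerE expr_card_dim subrr mulr0 add0r => ->.
  by rewrite subrr.
by apply/rowP => i; rewrite mxE PE coef_lpoly.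
Qed.

Lemma leval_lcomp f g x : leval (lcomp f g) x = leval f (leval g x).
Proof.
rewrite lcompE mulmx_sum_row [RHS]levalE [LHS]/leval linear_sum horner_sum.
apply: eq_bigr => i _.
by rewrite -/(leval _ x) leval_scalel rowK leval_lfrob.
Qed.

Lemma leval_lmono k x : (k < m)%N -> leval (lmono k : 'rV[L]_m) x = x ^+ (q ^ k).
Proof.
move=> lt_km; rewrite levalE (bigD1 (Ordinal lt_km)) //= mxE eqxx mul1r.
rewrite big1 ?addr0 // => i; rewrite -val_eqE mxE /= => /negPf->.
by rewrite mul0r.
Qed.

Lemma leval_surj (u : 'rV[L]_m) : (forall x, leval u x = 0 -> x = 0) ->
  forall y, exists x, leval u x = y.
Proof.
move=> u_inj y; have inj_u : injective (leval u : fL -> fL).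
  move=> x1 x2 eq_x; apply/eqP; rewrite -subr_eq0; apply/eqP/u_inj.
  by rewrite linearB /= eq_x subrr.
by exists (invF inj_u (y : fL)); rewrite [LHS](f_invF inj_u).
Qed.

(** Right division by [u]: a row killed by the Dickson matrix of [u] is a polynomial vanishing on
    the image of [u], which is all of L. *)
Lemma lcomp_surj (u v : 'rV[L]_m) : (forall x, leval u x = 0 -> x = 0) ->
  exists f, lcomp f u = v.
Proof.
move=> u_inj; pose M : 'M[L]_m := \matrix_i lfrob i u.
have uM : M \in unitmx.
  rewrite unitmxE unitfE; apply/det0P => -[f f0 fM]; case/eqP: f0.
  apply: leval_eq0 => y; have [x <-] := leval_surj u_inj y.
  by rewrite -leval_lcomp lcompE fM /leval linear0 horner0.
by exists (v *m invmx M); rewrite lcompE mulmxKV.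
Qed.

(** Right division gives a left inverse; it is two-sided because [u] is onto. *)
Lemma linvertibleP (u : 'rV[L]_m) : (forall x, leval u x = 0 -> x = 0) -> linvertible u.
Proof.
move=> u_inj; have m_gt0 := degree_gt0.
have [h hu] := lcomp_surj (lmono 0) u_inj; exists h; split=> //.
apply: leval_inj => y; have [x <-] := leval_surj u_inj y.
by rewrite leval_lcomp -(leval_lcomp h) hu !leval_lmono.
Qed.

End FixedDegree.

End LinearizedPolynomialFunctions.

Lemma proportional_rows (K : fieldType) (p r s t : K) : p * t = r * s ->
  exists a b, [/\ a * p + b * r = 0, a * s + b * t = 0 & (a != 0) || (b != 0)].
Proof.
move=> det0; have [/andP[/eqP-> /eqP->]|] := boolP ((p == 0) && (r == 0)).
  have [/andP[/eqP-> /eqP->]|] := boolP ((s == 0) && (t == 0)).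
    by exists 1, 0; rewrite !mulr0 addr0 oner_neq0.
  rewrite negb_and => st; exists t, (- s); rewrite oppr_eq0 orbC.
  by split=> //; ring.
rewrite negb_and => pr; exists r, (- p); rewrite oppr_eq0 orbC.
by split=> //; rewrite ?mulNr ?[p * t]det0; ring.
Qed.

(** * Two-dimensional MRD codes of length 4 *)

Section RankMetricCodes.

Variables (F : finFieldType) (L : fieldExtType F).
Hypothesis dimL : \dim {:L} = 4%N.

Local Notation q := #|F|.
Local Notation fL := (finvect_type L).
Local Notation phi := (@frob F L).

Lemma frob4 (x : L) : phi (phi (phi (phi x))) = x.
Proof. by rewrite -[LHS]/(iter 4 phi x) iter_frob expr_card_dim. Qed.

Lemma leval4 (f : 'rV[L]_4) x : leval f x =
  f 0 (@Ordinal 4 0 isT) * x + f 0 (@Ordinal 4 1 isT) * phi x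
  + f 0 (@Ordinal 4 2 isT) * phi (phi x)
  + f 0 (@Ordinal 4 3 isT) * phi (phi (phi x)).
Proof.
rewrite levalE !big_ord_recl big_ord0 addr0 !addrA -!iter_frob /=.
by congr (_ + _ + _ + _); congr (f 0 _ * _); apply: val_inj.
Qed.

Lemma frob_independent (c0 c1 c2 c3 : L) : c0 != 0 ->
  exists x, c0 * x + c1 * phi x + c2 * phi (phi x) + c3 * phi (phi (phi x)) != 0.
Proof.
move=> c0_neq0; pose r : 'rV[L]_4 := \row_(i < 4) [:: c0; c1; c2; c3]`_i.
case: (pickP (fun x : fL => leval r x != 0)) => [x|r0].
  by rewrite leval4 !mxE; exists x.
case/eqP: c0_neq0; have /rowP/(_ (@Ordinal 4 0 isT)) : r = 0.
  by apply: (leval_eq0 dimL) => x; apply/eqP; rewrite -[_ == _]negbK r0.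
by rewrite !mxE.
Qed.

Lemma nm4_frob (x : L) : nm4 phi x = x ^+ (1 + q + q ^ 2 + q ^ 3).
Proof.
rewrite -[LHS]/(x * iter 1 phi x * iter 2 phi x * iter 3 phi x) !iter_frob.
by rewrite !exprD expr1 expn1.
Qed.

Lemma frob2E (x : L) : phi (phi x) = x ^+ (q ^ 2).
Proof. by rewrite -[LHS]/(iter 2 phi x) iter_frob. Qed.

Lemma frob_quadratic_root (e n : L) : phi e = e -> phi n = n ->
  exists2 x, x ^+ 2 - e * x + n = 0 & phi (phi x) = x.
Proof. by apply: (@quadratic_root F L 2); rewrite (card_ext dimL) -expnM. Qed.

Lemma frob_norm_surjective1 (k : L) : phi k = k ->
  exists2 u, phi (phi u) = u & u * phi u = k.
Proof.
move=> kq; have [|u u2 uk] := @norm_root F L q 2 k _ kq.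
  by rewrite (card_ext dimL) -expnM.
by exists u; rewrite ?frob2E.
Qed.

Lemma frob_norm_surjective2 (k : L) : phi (phi k) = k ->
  exists z, z * phi (phi z) = k.
Proof.
rewrite frob2E => kq; have [|u u2 uk] := @norm_root F L (q ^ 2) 1 k _ kq.
  by rewrite (card_ext dimL) -!expnM.
by exists u; rewrite ?frob2E.
Qed.

Variable C : {vspace 'rV[L]_4}.
Hypotheses (mrdC : is_MRD C) (dimC : \dim C = 2%N).

Lemma MRD_rank f : f \in C -> f != 0 -> (3 <= lrank f)%N.
Proof. by case: mrdC; rewrite dimC => _ Crank /Crank. Qed.

(** Rank at least 3 in dimension 4 forces the kernel to be the line through [x]. *)
Lemma MRD_ker f x y : f \in C -> f != 0 -> leval f x = 0 -> leval f y = 0 ->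
  x != 0 -> exists c : F, y = c *: x.
Proof.
move=> fC f0 fx fy x0; pose lf := linfun (leval f).
have dim_ker : (\dim (lker lf) <= 1)%N.
  have := MRD_rank fC f0; rewrite /lrank -/lf => rk.
  have := limg_ker_dim lf fullv; rewrite capfv dimL => dimE.
  by rewrite -(leq_add2r (\dim (limg lf))) dimE (leq_trans _ (leq_add (leqnn 1) rk)).
have ker_x : (<[x]> == lker lf)%VS.
  by rewrite eqEdim -memvE memv_ker lfunE /= fx eqxx dim_vline x0.
have : y \in <[x]>%VS by rewrite (eqP ker_x) memv_ker lfunE /= fy.
by case/vlineP => c ->; exists c.
Qed.

Lemma dim2_basis v w : v \in C -> w \in C -> v != 0 -> w \notin <[v]>%VS ->
  C = (<[v]> + <[w]>)%VS.
Proof.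
move=> vC wC v0 wv; apply/eqP; rewrite eq_sym eqEdim subv_add -!memvE vC wC dimC /=.
rewrite ltnNge; apply: contra wv => dim1.
have : (<[v]> == <[v]> + <[w]>)%VS by rewrite eqEdim addvSl dim_vline v0.
by move=> /eqP->; rewrite memvE addvSr.
Qed.

Lemma memv_add_line (v w f : 'rV[L]_4) :
  f \in (<[v]> + <[w]>)%VS <-> exists a b, f = a *: v + b *: w.
Proof.
split=> [/memv_addP[_ /vlineP[a ->] [_ /vlineP[b ->] ->]]|[a [b ->]]].
  by exists a, b.
by rewrite memv_add ?memvZ ?memv_line.
Qed.

(** Were x nonzero, take y outside its line: the nonzero codeword v(y) w - w(y) v would vanish at
    both x and y. *)
Lemma no_common_zero v w x : v \in C -> w \in C -> v != 0 ->
  w \notin <[v]>%VS -> leval v x = 0 -> leval w x = 0 -> x = 0.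
Proof.
move=> vC wC v0 wv vx wx; apply/eqP/negPn/negP => x0.
have [y _ yx] : exists2 y, y \in {:L}%VS & y \notin <[x]>%VS.
  apply/subvPn; apply/negP => /dimvS; rewrite dimL dim_vline.
  by case: (x != 0).
have zero_y f : f \in C -> f != 0 -> leval f x = 0 -> leval f y != 0.
  move=> fC f0 fx; apply/eqP => fy; case/negP: yx.
  by have [c ->] := MRD_ker fC f0 fx fy x0; rewrite memvZ ?memv_line.
have vy := zero_y v vC v0 vx.
have eC : leval v y *: w - leval w y *: v \in C by rewrite memvB ?memvZ.
have e0 : leval v y *: w - leval w y *: v != 0.
  apply: contra wv; rewrite subr_eq0 => /eqP ev.
  by rewrite -[w](scalerK vy) ev !memvZ ?memv_line.
have := zero_y _ eC e0; rewrite !leval_subl !leval_scalel vx wx !mulr0 subrr.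
by move=> /(_ erefl); rewrite mulrC subrr eqxx.
Qed.

Lemma invertible_codeword :
  exists2 u, u \in C & forall x, leval u x = 0 -> x = 0.
Proof.
have C0 : C != 0%VS by rewrite -dimv_eq0 dimC.
pose v := vpick C; have vC : v \in C := memv_pick C.
have v0 : v != 0 by rewrite vpick0.
have [w wC wv] : exists2 w, w \in C & w \notin <[v]>%VS.
  by apply/subvPn; apply/negP => /dimvS; rewrite dimC dim_vline v0.
(* w + t v has a nonzero root x only if t = - w(x) / v(x): some t is missed. *)
pose ratio (x : fL) : fL := - leval w x / leval v x.
have [t tP] : exists t : fL, t \notin [set ratio x | x in [set~ 0]].
  apply/existsP; rewrite -negb_forall; apply/negP => /forallP ratio_onto.
  have : (#|fL| <= #|[set ratio x | x in [set~ (0%R : fL)]]|)%N.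
    by apply: subset_leq_card; apply/subsetP => t _; apply: ratio_onto.
  rewrite leqNgt (leq_ltn_trans (leq_imset_card _ _)) //.
  by rewrite cardsC1 ltn_predL (ltnW (finNzRing_gt1 fL)).
exists (w + t *: v); first by rewrite memvD ?memvZ.
move=> x; rewrite leval_addl leval_scalel => ux.
have [vx|vx] := eqVneq (leval v x) 0.
  by apply: (no_common_zero vC wC v0 wv vx); rewrite -ux vx mulr0 addr0.
apply/eqP; apply: contraR tP => x0; apply/imsetP; exists x; first by rewrite !inE.
by apply: (mulIf vx); rewrite divfK //; apply/eqP; rewrite -addr_eq0 addrC ux.
Qed.

Lemma frob_codeword_independent g h (lam nu : L) : g \in C -> g != 0 ->
  (lam != 0) || (nu != 0) ->
  (forall x, leval h x = lam * phi (leval g x) + nu * phi (phi (phi (leval g x)))) ->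
  h \notin <[g]>%VS.
Proof.
move=> gC g0 lam_nu hE; apply/negP => /vlineP[k hk].
(* Otherwise the image of g, of size at least q^3, consists of roots of p. *)
pose p : {poly L} := phi nu *: 'X - phi k *: 'X^q + phi lam *: 'X^(q ^ 2).
have q_gt1 := finNzRing_gt1 F.
have q2_gtq : (q < q ^ 2)%N by rewrite ltn_Pmulr // ltnW.
have q2_gt1 := ltn_trans q_gt1 q2_gtq.
have sz_p : (size p <= (q ^ 2).+1)%N.
  have szX c k' : (k' <= q ^ 2)%N -> (size (c *: 'X^k' : {poly L}) <= (q ^ 2).+1)%N.
    by move=> ?; rewrite (leq_trans (size_scale_leq _ _)) // size_polyXn.
  rewrite (leq_trans (size_polyD _ _)) // geq_max szX // andbT.
  rewrite (leq_trans (size_polyD _ _)) // geq_max size_polyN.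
  by rewrite (szX _ 1%N) ?szX // ltnW.
have p0 : p != 0.
  apply/eqP => /polyP p0; case/orP: lam_nu; case/eqP; apply/eqP.
    have := p0 (q ^ 2)%N; rewrite !(coefD, coefN, coefZ, coefX, coefXn) coef0.
    rewrite eqxx !gtn_eqF // !mulr0 mulr1 subrr add0r.
    by move/eqP; rewrite fmorph_eq0.
  have := p0 1%N; rewrite !(coefD, coefN, coefZ, coefX, coefXn) coef0.
  rewrite eqxx !ltn_eqF // !mulr0 mulr1 subr0 addr0.
  by move/eqP; rewrite fmorph_eq0.
pose im : {vspace fL} := limg (linfun (leval g)).
have roots_p : all (root p) (enum im).
  apply/allP => y; rewrite (@mem_enum fL) => /memv_imgP[x _ ->]; rewrite lfunE /=.
  (* Applying phi to k y = lam phi(y) + nu phi^3(y) turns phi^3 into the identity and lowers the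
     degree bound from q^3 to q^2. *)
  have := hE x; rewrite hk leval_scalel => /(congr1 phi).
  rewrite !(rmorphD, rmorphM) /= frob4 => kE.
  by rewrite rootE !hornerE -frob2E -/(phi _) kE; apply/eqP; ring.
have : (size (enum im) < size p)%N := max_poly_roots p0 roots_p (enum_uniq im).
rewrite -cardE card_vspace => /leq_trans/(_ sz_p); rewrite ltnS leqNgt => /negP[].
by rewrite ltn_exp2l //; apply: (MRD_rank gC g0).
Qed.

Lemma frobenius_pair : exists g h (lam nu : L),
  [/\ g \in C, h \in C, g != 0, (lam != 0) || (nu != 0) &
   forall x, leval h x
     = lam * phi (leval g x) + nu * phi (phi (phi (leval g x)))].
Proof.
have [u uC u_inj] := invertible_codeword.
have u0 : u != 0.
  apply/eqP => u0; case/eqP: (oner_neq0 L); apply: u_inj.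
  by rewrite u0 /leval linear0 horner0.
have [v vC vu] : exists2 v, v \in C & v \notin <[u]>%VS.
  by apply/subvPn; apply/negP => /dimvS; rewrite dimC dim_vline u0.
have [f fE] := lcomp_surj dimL v u_inj.
have [d [a [b [c vE]]]] : exists d a b c : L, forall x, leval v x =
    d * leval u x + a * phi (leval u x) + b * phi (phi (leval u x))
    + c * phi (phi (phi (leval u x))).
  do 4!eexists; move=> x; rewrite -fE (leval_lcomp dimL) leval4; reflexivity.
have w0 : v - d *: u != 0.
  apply: contra vu; rewrite subr_eq0 => /eqP->.
  by rewrite memvZ ?memv_line.
have [b0|b0] := eqVneq b 0.
  exists u, (v - d *: u), a, c; split=> //; first by rewrite memvB ?memvZ.
    apply: contraR w0; rewrite negb_or !negbK => /andP[/eqP a0 /eqP c0].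
    apply/eqP/(leval_eq0 dimL) => x.
    by rewrite leval_subl leval_scalel vE a0 b0 c0; ring.
  by move=> x; rewrite leval_subl leval_scalel vE b0; ring.
(* With g = v + (s - d) u, the vectors phi o g and phi^3 o g are dependent modulo
   C iff the 2 x 2 determinant of their coordinates on phi o u and phi^3 o u,
   after elimination of phi^2 o u by means of v, vanishes. *)
have [t tE] := semilinear_equation frob4 frob_quadratic_root
  frob_norm_surjective2 a c b0.
have [lam [nu [col1 col3 lam_nu]]] :
    exists lam nu, [/\
      lam * (t - a * phi a / b)
        + nu * (phi (phi (phi b)) - a * phi (phi (phi c)) / b) = 0,
      lam * (phi b - c * phi a / b)
        + nu * (phi (phi t) - c * phi (phi (phi c)) / b) = 0
      & (lam != 0) || (nu != 0)].
  apply: proportional_rows; rewrite mulrC [LHS]tE /=; ring.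
(* [k] matches the coefficients of phi^2(u), and the multiple of u added to h matches those of u. As
   phi(s) = t, [col1] and [col3] match those of phi(u) and phi^3(u). *)
pose k := (lam * phi a + nu * phi (phi (phi c))) / b.
pose s := phi (phi (phi t)).
exists (v + (s - d) *: u).
exists (k *: (v - d *: u) + (lam * phi c + nu * phi (phi (phi a))) *: u), lam, nu.
split=> //.
- by rewrite memvD ?memvZ.
- by rewrite memvD ?memvZ ?memvB ?memvZ.
- apply: contra vu; rewrite addr_eq0 => /eqP->.
  by rewrite memvN memvZ ?memv_line.
move=> x; rewrite /k /s !(leval_subl, leval_addl, leval_scalel) vE.
rewrite !(rmorphD, rmorphN, rmorphM) /= !frob4.
apply/eqP; rewrite -subr_eq0; apply/eqP.
move: (leval u x) => U.
transitivity (- (phi U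
    * (lam * (t - a * phi a / b)
        + nu * (phi (phi (phi b)) - a * phi (phi (phi c)) / b)))
  - phi (phi (phi U))
    * (lam * (phi b - c * phi a / b)
        + nu * (phi (phi t) - c * phi (phi (phi c)) / b))).
  by field.
by rewrite col1 col3; ring.
Qed.

(** If nu = 0, then h is a multiple of phi o g, so G = g and delta = 0. Otherwise G = phi^3 o g
    gives g = phi o G and h / nu = G + (lam / nu) phi^2 o G. *)
Lemma normal_form : exists g1 g2 (G : 'rV[L]_4) delta,
  [/\ forall f, f \in C <-> exists a b, f = a *: g1 + b *: g2,
      forall x, leval G x = 0 -> x = 0,
      forall x, leval g1 x = phi (leval G x) &
      forall x, leval g2 x = leval G x + delta * phi (phi (leval G x))].
Proof.
have [g [h [lam [nu [gC hC g0 lam_nu hE]]]]] := frobenius_pair.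
have hg := frob_codeword_independent gC g0 lam_nu hE.
have g_inj x : leval g x = 0 -> x = 0.
  by move=> gx; apply: (no_common_zero gC hC g0 hg gx); rewrite hE gx !rmorph0; ring.
have CE f : f \in C <-> exists a b, f = a *: g + b *: h.
  by rewrite {1}(dim2_basis gC hC g0 hg); apply: memv_add_line.
have [nu0|nu0] := eqVneq nu 0.
  rewrite nu0 eqxx orbF in lam_nu.
  exists (lam^-1 *: h), g, g, 0; split=> //.
  - move=> f; rewrite CE; split=> -[a [b ->]].
      by exists (b * lam), a; rewrite scalerA mulfK // addrC.
    by exists b, (a / lam); rewrite scalerA addrC.
  - by move=> x; rewrite leval_scalel hE nu0; field.
  - by move=> x; ring.
exists g, (nu^-1 *: h), (lcomp (lmono 3) g), (lam / nu).
have GE x : leval (lcomp (lmono 3) g) x = phi (phi (phi (leval g x))).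
  by rewrite (leval_lcomp dimL) leval_lmono // -iter_frob.
split=> //.
- move=> f; rewrite CE; split=> -[a [b ->]].
    by exists a, (b * nu); rewrite scalerA mulfK.
  by exists a, (b / nu); rewrite scalerA.
- by move=> x /eqP; rewrite GE !fmorph_eq0 => /eqP; apply: g_inj.
- by move=> x; rewrite GE frob4.
- by move=> x; rewrite GE frob4 leval_scalel hE; field.
Qed.

(** For norm 1, [norm1_degenerate] yields a nonzero codeword vanishing at the preimages of X and t X
    under G. These would be proportional over F, contradicting phi(t) != t. *)
Lemma normal_form_norm g1 g2 (G : 'rV[L]_4) delta :
  g1 \in C -> g2 \in C -> (forall x, leval G x = 0 -> x = 0) ->
  (forall x, leval g1 x = phi (leval G x)) ->
  (forall x, leval g2 x = leval G x + delta * phi (phi (leval G x))) ->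
  nm4 phi delta != 1.
Proof.
move=> g1C g2C G_inj g1E g2E; apply/eqP.
case/(norm1_degenerate frob4 frob_independent frob_norm_surjective1).
move=> X [t [/= X0 t_neq XtE]].
have G_surj := leval_surj G_inj.
pose e := (X + delta * phi (phi X)) *: g1 - phi X *: g2.
have eE x : leval e x = (X + delta * phi (phi X)) * phi (leval G x)
    - phi X * (leval G x + delta * phi (phi (leval G x))).
  by rewrite leval_subl !leval_scalel g1E g2E.
have eC : e \in C by rewrite memvB ?memvZ.
have e0 : e != 0.
  have pX0 : - phi X != 0 by rewrite oppr_eq0 fmorph_eq0.
  have [y] := frob_independent (X + delta * phi (phi X)) (- phi X * delta) 0 pX0.
  apply: contraNneq => e0; have [x xy] := G_surj y.
  have := eE x; rewrite e0 xy {1}/leval linear0 horner0 => yE.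
  by apply/eqP; rewrite [RHS]yE; ring.
have [x1 Gx1] := G_surj X; have [x2 Gx2] := G_surj (t * X).
have ex1 : leval e x1 = 0 by rewrite eE Gx1; ring.
have ex2 : leval e x2 = 0.
  by rewrite eE Gx2 XtE; ring.
have x10 : x1 != 0 by apply: contraNneq X0 => x10; rewrite -Gx1 x10 linear0.
have [c x2E] := MRD_ker eC e0 ex1 ex2 x10.
case/eqP: t_neq; have -> : t = c%:A; last exact: frob_alg.
by apply: (mulIf X0); rewrite -Gx2 x2E linearZ /= Gx1 mulr_algl.
Qed.

End RankMetricCodes.

Theorem theorem3p3 (F : finFieldType) (L : fieldExtType F)
    (q : nat) (hq : #|F| = q) (hL : \dim {:L} = 4%N)
    (C : {vspace 'rV[L]_4}) (hMRD : is_MRD C) (hdim : \dim C = 2%N) :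
  exists2 delta : L,
    delta ^+ (1 + q + q ^ 2 + q ^ 3) != 1
    & linearly_equivalent C (T214 delta).
Proof.
have [g1 [g2 [G [delta [CE G_inj g1E g2E]]]]] := normal_form hL hMRD hdim.
have g1C : g1 \in C by apply/CE; exists 1, 0; rewrite scale1r scale0r addr0.
have g2C : g2 \in C by apply/CE; exists 0, 1; rewrite scale1r scale0r add0r.
exists delta.
  by rewrite -hq -nm4_frob (normal_form_norm hL hMRD hdim g1C g2C G_inj g1E g2E).
have TE f : f \in T214 delta <-> exists a b,
    f = a *: lmono 1 + b *: (lmono 0 + delta *: lmono 2).
  by rewrite /T214 span_cons span_seq1; apply: memv_add_line.
have compE a b : a *: g1 + b *: g2
    = lcomp (a *: lmono 1 + b *: (lmono 0 + delta *: lmono 2)) G.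
  apply: (leval_inj hL) => x; rewrite (leval_lcomp hL).
  rewrite !(leval_addl, leval_scalel) !leval_lmono // g1E g2E -!iter_frob /=.
  by rewrite mulrDr.
exists G; first exact: (linvertibleP hL).
move=> f; rewrite CE; split=> [[a [b ->]]|[f' /TE[a [b ->]] ->]].
  exists (a *: lmono 1 + b *: (lmono 0 + delta *: lmono 2)) => //.
  by apply/TE; exists a, b.
by exists a, b.
Qed.
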